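(* Let $a,b,m,n$ be positive integers. Then $$\frac{abm}{(a+b)(m+n)}\binom{am+bm}{am}\binom{an+bn}{an}=\frac{am}{m+n}\binom{am+bm-1}{am}\binom{an+bn}{an}\in\mathbb{Z}.$$
   Context: $\mathbb{Z}$ denotes the set of integers. *)

(* Defs.v *)
From mathcomp Require Export all_boot all_order all_algebra.

(* Main.v *)
Require Import Defs.
From mathcomp Require Import all_boot all_order all_algebra.
From mathcomp Require Import zify ring.

(** Write A = am, B = bm, C = an, D = bn and N = m + n.  The number in question
    is (A+B-1)! (C+D)! / (N (A-1)! (B-1)! C! D!), where N divides A + C and
    B + D.  By Legendre's formula it suffices to compare, for every prime power
    d, the floors of these integers divided by d.  If d divides N, the residues
    of A - 1 and C add up to d - 1, and likewise for (B - 1, D) and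
    (A + B - 1, C + D), so the contributions of d cancel exactly; otherwise
    superadditivity of the floor function is enough. *)

(** A common cutoff [K] lets the Legendre sums of several factorials be compared term by term; the
    added terms vanish since [n < p ^ k]. *)
Lemma logn_fact_widen (p n K : nat) : prime p -> n < K ->
  logn p n`! = \sum_(1 <= k < K) n %/ p ^ k.
Proof.
move=> pr_p ltnK; rewrite logn_fact // [RHS](@big_cat_nat _ _ _ n.+1) //=.
rewrite [X in _ + X]big_nat_cond [X in _ + X]big1 ?addn0 // => k.
rewrite andbT => /andP[ltnk _].
by rewrite divn_small // (ltn_trans ltnk) // ltn_expl // prime_gt1.
Qed.

Lemma logn_count_dvd_widen (p n K : nat) : prime p -> 0 < n <= K ->
  logn p n = \sum_(1 <= k < K) (p ^ k %| n).
Proof.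
move=> pr_p /andP[n_gt0 lenK].
rewrite logn_count_dvd // [RHS](@big_cat_nat _ _ _ n) //=.
rewrite [X in _ + X]big_nat_cond [X in _ + X]big1 ?addn0 // => k.
rewrite andbT => /andP[lenk _].
by rewrite gtnNdvd // (leq_ltn_trans lenk) // ltn_expl // prime_gt1.
Qed.

Lemma logn_dvdn (m n : nat) : 0 < m -> 0 < n ->
  (forall p, prime p -> logn p m <= logn p n) -> m %| n.
Proof.
move=> m_gt0 n_gt0 le_log; apply/dvdn_partP => // p.
by rewrite mem_primes p_part => /andP[pr_p _]; rewrite pfactor_dvdn ?le_log.
Qed.

Lemma divn_compl (d x z : nat) : 0 < d -> d %| (x + z).+1 ->
  (x %/ d + z %/ d).+1 = (x + z).+1 %/ d.
Proof.
move=> d_gt0 /dvdnP[u def_u]; rewrite def_u mulnK //.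
have := divn_eq x d; have := divn_eq z d.
have := ltn_pmod x d_gt0; have := ltn_pmod z d_gt0.
move: (x %/ d) (z %/ d) (x %% d) (z %% d) => q q' r r' lt_r' lt_r def_z def_x.
(* Since [1 <= r + r' + 1 <= 2d - 1], the multiple [u * d] is squeezed, forcing [u = q + q' + 1]. *)
have : (q + q') * d < u * d < (q + q').+2 * d by rewrite -def_u; lia.
by rewrite !ltn_pmul2r //; lia.
Qed.

Lemma dvdn_fact_compl (N x y z w : nat) : N %| (x + z).+1 -> N %| (y + w).+1 ->
  N * (x`! * y`! * (z`! * w`!)) %| (x + y).+1`! * (z + w)`!.
Proof.
move=> dvdNxz dvdNyw; have N_gt0 : 0 < N by case: N dvdNxz {dvdNyw}.
apply: logn_dvdn => [||p pr_p]; rewrite ?muln_gt0 ?N_gt0 ?fact_gt0 //.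
pose K := (N + x + y + z + w).+2.
(* The factorial of a successor is itself a product; naming it [F] keeps it whole under [lognM]. *)
have := fact_gt0 (x + y).+1; move def_F: (x + y).+1`! => F F_gt0.
rewrite !lognM ?muln_gt0 ?fact_gt0 // -def_F.
rewrite (@logn_count_dvd_widen _ N K) ?N_gt0 //; last by rewrite /K; lia.
rewrite !(@logn_fact_widen _ _ K) //; try by rewrite /K; lia.
rewrite -!big_split /=.
apply: leq_sum => k _.
have d_gt0 : 0 < p ^ k by rewrite expn_gt0 prime_gt0.
move: (p ^ k) d_gt0 => d d_gt0.
have [dvd_dN|_] := boolP (d %| N); last first.
  rewrite add0n leq_add //; last by rewrite divnD // leq_addr.
  by rewrite (leq_trans _ (leq_div2r d (leqnSn _))) // divnD // leq_addr.
have dvd1 := dvdn_trans dvd_dN dvdNxz; have dvd2 := dvdn_trans dvd_dN dvdNyw.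
(* Thus [d] divides this sum too. Applying [divn_compl] to all three pairs, the right side gains
   exactly one unit, which pays for the term of [N]. *)
have def_sum : ((x + y).+1 + (z + w)).+1 = (x + z).+1 + (y + w).+1 by lia.
have := divn_compl _ (x + y).+1 (z + w) d_gt0.
rewrite def_sum (divnDl _ dvd1) => /(_ (dvdn_add dvd1 dvd2)).
rewrite -(divn_compl _ _ _ d_gt0 dvd1) -(divn_compl _ _ _ d_gt0 dvd2).
by move: (_ %/ d) (_ %/ d) (_ %/ d) (_ %/ d) (_ %/ d) (_ %/ d) => *; lia.
Qed.

(** The product is [(x + y).+1]! * (z + w)[!] divided by [x]! * y[! * (z]! * w[!)]. *)
Lemma dvdn_mul_bin_compl (N x y z w : nat) :
  N %| (x + z).+1 -> N %| (y + w).+1 ->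
  N %| x.+1 * 'C((x + y).+1, x.+1) * 'C(z + w, z).
Proof.
move=> dvd1 dvd2.
have f_gt0 : 0 < x`! * y`! * (z`! * w`!) by rewrite !muln_gt0 !fact_gt0.
rewrite -(dvdn_pmul2r f_gt0).
have <- : (x + y).+1`! * (z + w)`!
    = x.+1 * 'C((x + y).+1, x.+1) * 'C(z + w, z) * (x`! * y`! * (z`! * w`!)).
  have := @bin_fact (x + y).+1 x.+1; have := @bin_fact (z + w) z.
  rewrite subSS !addKn factS ltnS !leq_addr => /(_ isT) <- /(_ isT) <-.
  by move: 'C(_, _) 'C(_, _) x`! y`! z`! w`! => *; lia.
exact: dvdn_fact_compl.
Qed.

Local Open Scope ring_scope.
Import GRing.Theory Num.Theory.

Theorem theorem1p4 (a b m n : nat)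
    (ha : (0 < a)%N) (hb : (0 < b)%N) (hm : (0 < m)%N) (hn : (0 < n)%N) :
  (a * b * m)%:R / ((a + b) * (m + n))%:R
      * 'C(a * m + b * m, a * m)%:R * 'C(a * n + b * n, a * n)%:R
    = (a * m)%:R / (m + n)%:R
      * 'C(a * m + b * m - 1, a * m)%:R * 'C(a * n + b * n, a * n)%:R :> rat
  /\ (a * m)%:R / (m + n)%:R
      * 'C(a * m + b * m - 1, a * m)%:R * 'C(a * n + b * n, a * n)%:R
     \in (Num.int : {pred rat}).
Proof.
have nat_neq0 (k : nat) : (0 < k)%N -> k%:R != 0 :> rat.
  by rewrite pnatr_eq0 -lt0n.
have N_neq0 : (m + n)%:R != 0 :> rat by apply: nat_neq0; lia.
have ab_neq0 : (a + b)%:R != 0 :> rat by apply: nat_neq0; lia.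
split; first congr (_ * _).
  have bin_eq : (b * 'C(a * m + b * m, a * m)
      = (a + b) * 'C(a * m + b * m - 1, a * m))%N.
    (* [mul_bin_down] yields the factors [b * m] and [(a + b) * m], hence the extra [m]. *)
    apply/eqP; rewrite -(eqn_pmul2l hm); apply/eqP.
    have := mul_bin_down (a * m + b * m) (a * m).
    by rewrite addKn -subn1; lia.
  move/(congr1 (fun k => k%:R : rat)): bin_eq.
  rewrite [LHS]natrM [RHS]natrM => bin_eq.
  rewrite -[in RHS](mulKf ab_neq0 'C(_ - 1, _)%:R) -bin_eq !natrM.
  by field; rewrite -!natrD N_neq0 ab_neq0.
have /dvdnP[q def_q] :
    (m + n %| a * m * 'C(a * m + b * m - 1, a * m) * 'C(a * n + b * n, a * n))%N.
  (* With [z = a * n] and [w = b * n], the two sums become [a * (m + n)] and [b * (m + n)]. *)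
  have [x def_x] : exists x, (a * m)%N = x.+1 by exists (a * m).-1; lia.
  have [y def_y] : exists y, (b * m)%N = y.+1 by exists (b * m).-1; lia.
  rewrite def_x def_y addSn addnS subn1 /=; apply: dvdn_mul_bin_compl.
    by rewrite -addSn -def_x -mulnDr dvdn_mull.
  by rewrite -addSn -def_y -mulnDr dvdn_mull.
suff -> : (a * m)%:R / (m + n)%:R * 'C(a * m + b * m - 1, a * m)%:R
    * 'C(a * n + b * n, a * n)%:R = q%:R :> rat by rewrite natr_int.
apply: (mulIf N_neq0); rewrite -natrM -def_q !natrM.
by field; rewrite -natrD.
Qed.
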